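(* For each Casimir element $\Omega$ of $\Re$ there exists a unique four-variable polynomial $P(x_1,x_2,x_3,x_4)$ over $\mathbb F$ such that $$\zeta(\Omega)=P(\iota,\kappa,\lambda,\mu)$$ in $\mathfrak{BI}$ (that is, $\Omega=P(\iota,\kappa,\lambda,\mu)$ when $\Re$ is viewed as an $\mathbb F$-subalgebra of $\mathfrak{BI}$ via the injective homomorphism $\zeta$).
   Context: $\mathbb F$ is a field with $\operatorname{char}\mathbb F\neq 2$. Algebras are associative with unit $1$. $[a,b]=ab-ba$ and $\{a,b\}=ab+ba$. The Racah algebra $\Re$ is the $\mathbb F$-algebra defined by generators $A,B,C,D$ and the relations asserting that $[A,B]=[B,C]=[C,A]=2D$ and that each of $\alpha=[A,D]+AC-BA$, $\beta=[B,D]+BA-CB$, $\gamma=[C,D]+CB-AC$ is central in $\Re$. Put $\delta=A+B+C$, which is also central in $\Re$. Let $\mathfrak C$ be the commutative $\mathbb F$-subalgebra of $\Re$ generated by $\alpha,\beta,\gamma,\delta$. A Casimir element of $\Re$ is an element of the coset $$D^2+A^2+B^2+\frac{(\delta+2)\{A,B\}-\{A^2,B\}-\{A,B^2\}}{2}+A(\beta-\delta)+B(\delta-\alpha)+\mathfrak C.$$ The Bannai--Ito algebra $\mathfrak{BI}$ is the $\mathbb F$-algebra defined by generators $X,Y,Z$ and the relations asserting that each of $\kappa=\{X,Y\}-Z$, $\lambda=\{Y,Z\}-X$, $\mu=\{Z,X\}-Y$ is central in $\mathfrak{BI}$. Put $\iota=X+Y+Z$. (Since $\kappa,\lambda,\mu$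 are central, $\iota,\kappa,\lambda,\mu$ mutually commute.) $\zeta\colon\Re\to\mathfrak{BI}$ is the unique $\mathbb F$-algebra homomorphism (known to exist) that sends $A\mapsto \frac{(2X-3)(2X+1)}{16}$, $B\mapsto \frac{(2Y-3)(2Y+1)}{16}$, $C\mapsto\frac{(2Z-3)(2Z+1)}{16}$.
   Formalization: In the coset defining Casimir elements, the last term +B(δ−α) is replaced by −B(δ+α); as printed the element does not commute with A, since [A,2Bδ]=4Dδ≠0, and the claim fails for every element of the coset. *)

(* Defs.v *)
From HB Require Import structures.
From mathcomp Require Import all_boot all_algebra.
From mathcomp Require Import finmap boolp monalg.

Set Implicit Arguments.
Unset Strict Implicit.
Unset Printing Implicit Defensive.

Import GRing.Theory.
Local Open Scope ring_scope.
Local Open Scope quotient_scope.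

Definition commutator (V : nzRingType) (a b : V) : V := a * b - b * a.
Definition anticommutator (V : nzRingType) (a b : V) : V := a * b + b * a.

Inductive two_sided_ideal (V : nzRingType) (S : V -> Prop) : V -> Prop :=
| ideal_gen x : S x -> two_sided_ideal S x
| ideal_zero : two_sided_ideal S 0
| ideal_add x y :
    two_sided_ideal S x -> two_sided_ideal S y -> two_sided_ideal S (x + y)
| ideal_mul a x b : two_sided_ideal S x -> two_sided_ideal S (a * x * b).

Lemma ideal_kernel (V W : nzRingType) (phi : {rmorphism V -> W})
    (S : V -> Prop) :
  (forall r, S r -> phi r = 0) -> forall x, two_sided_ideal S x -> phi x = 0.
Proof.
move=> S0 x; elim=> {x} [x /S0 //| |x y _ x0 _ y0|a x b _ x0].
- by rewrite raddf0.
- by rewrite raddfD /= x0 y0 addr0.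
- by rewrite !rmorphM x0 mulr0 mul0r.
Qed.

(* The F-subalgebra generated by the elements of the list gens. *)
Definition generated_subalg (F : fieldType) (V : algType F) (gens : seq V)
    (c : V) : Prop :=
  forall S : {pred V},
    GRing.subalg_closed S -> {subset gens <= S} -> c \in S.

(* The free unital associative F-algebra on x_0, ..., x_(n-1), realized as the
   monoid algebra of the free monoid on 'I_n. *)
Definition free_alg (F : fieldType) (n : nat) := {malg F[{fmonom 'I_n}]}.

HB.instance Definition _ (F : fieldType) (n : nat) :=
  GRing.Lalgebra.on (free_alg F n).

Lemma free_scaleAr (F : fieldType) (n : nat) (a : F) (x y : free_alg F n) :
  a *: (x * y) = x * (a *: y).
Proof.
have scaleE (b : F) (z : {malg F[{fmonom 'I_n}]}) : b *: z = b%:MP * z.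
  by rewrite mul_malgC.
have comm_malgC (b : F) (z : {malg F[{fmonom 'I_n}]}) : b%:MP * z = z * b%:MP.
  rewrite [z]monalgE mulr_sumr mulr_suml.
  apply: eq_bigr => k _; rewrite !malgM_def !fgmulUU mulrC.
  by rewrite mulm1 mul1m.
change (a *: (x * y : {malg F[{fmonom 'I_n}]}) =
  (x : {malg F[{fmonom 'I_n}]}) * (a *: (y : {malg F[{fmonom 'I_n}]}))).
by rewrite !scaleE !mulrA comm_malgC.
Qed.

HB.instance Definition _ (F : fieldType) (n : nat) :=
  GRing.Lalgebra_isAlgebra.Build F (free_alg F n) (@free_scaleAr F n).

Definition free_gen (F : fieldType) (n : nat) (i : 'I_n) : free_alg F n :=
  << fmu i >>.

Section Quotient.
Context (F : fieldType) (V : algType F) (S : V -> Prop).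
Context (S_proper : ~ two_sided_ideal S 1).
Local Notation ideal := (two_sided_ideal S).

Lemma ideal_mull (a x : V) : ideal x -> ideal (a * x).
Proof. by move=> Ix; rewrite -[a * x]mulr1; apply: ideal_mul. Qed.

Lemma ideal_mulr (x b : V) : ideal x -> ideal (x * b).
Proof. by move=> Ix; rewrite -[x]mul1r; apply: ideal_mul. Qed.

Lemma ideal_opp (x : V) : ideal x -> ideal (- x).
Proof. by move=> Ix; rewrite -mulN1r; apply: ideal_mull. Qed.

Definition quot_rel (x y : V) : bool := `[< ideal (x - y) >].

Lemma quot_rel_refl : reflexive quot_rel.
Proof. by move=> x; apply/asboolP; rewrite subrr; apply: ideal_zero. Qed.

Lemma quot_rel_sym : symmetric quot_rel.
Proof.
by move=> x y; apply/asboolP/asboolP => /ideal_opp; rewrite opprB.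
Qed.

Lemma quot_rel_trans : transitive quot_rel.
Proof.
move=> y x z /asboolP xy /asboolP yz; apply/asboolP.
by rewrite -(subrKA y); apply: ideal_add.
Qed.

Canonical quot_equiv :=
  EquivRel quot_rel quot_rel_refl quot_rel_sym quot_rel_trans.

(* The quotient of V by the two-sided ideal generated by S.  MathComp algebras
   satisfy 1 != 0, so the type carries a proof that the ideal is proper. *)
Definition quot_alg_of of ~ two_sided_ideal S 1 := {eq_quot quot_equiv}.
Local Notation quot_alg := (quot_alg_of S_proper).

HB.instance Definition _ := Choice.on quot_alg.

Definition quot_proj (x : V) : quot_alg := \pi_({eq_quot quot_equiv}) x.
Definition quot_repr (u : quot_alg) : V := repr (u : {eq_quot quot_equiv}).

Lemma quot_projP x y : quot_proj x = quot_proj y <-> ideal (x - y).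
Proof.
split=> [/eqP|I]; first by rewrite /quot_proj eqmodE => /asboolP.
by apply/eqP; rewrite /quot_proj eqmodE; apply/asboolP.
Qed.

Lemma quot_projK (u : quot_alg) : quot_proj (quot_repr u) = u.
Proof. exact: reprK. Qed.

Lemma quot_reprK x : ideal (quot_repr (quot_proj x) - x).
Proof. by apply/quot_projP; rewrite quot_projK. Qed.

(* The operations are locked: otherwise failing unification problems unfold
   down to the construction of V. *)
Fact quot_key : unit. Proof. by []. Qed.

Definition quot_zero : quot_alg := locked_with quot_key (quot_proj 0).
Definition quot_one : quot_alg := locked_with quot_key (quot_proj 1).
Definition quot_opp : quot_alg -> quot_alg :=
  locked_with quot_key (fun u => quot_proj (- quot_repr u)).
Definition quot_add : quot_alg -> quot_alg -> quot_alg :=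
  locked_with quot_key (fun u v => quot_proj (quot_repr u + quot_repr v)).
Definition quot_mul : quot_alg -> quot_alg -> quot_alg :=
  locked_with quot_key (fun u v => quot_proj (quot_repr u * quot_repr v)).
Definition quot_scale : F -> quot_alg -> quot_alg :=
  locked_with quot_key (fun a u => quot_proj (a *: quot_repr u)).

Lemma quot_zeroE : quot_zero = quot_proj 0.
Proof. by rewrite /quot_zero unlock. Qed.

Lemma quot_oneE : quot_one = quot_proj 1.
Proof. by rewrite /quot_one unlock. Qed.

Lemma quot_oppE x : quot_opp (quot_proj x) = quot_proj (- x).
Proof.
rewrite /quot_opp unlock; apply/quot_projP; rewrite -opprD; apply/ideal_opp/quot_reprK.
Qed.

Lemma quot_addE x y :
  quot_add (quot_proj x) (quot_proj y) = quot_proj (x + y).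
Proof.
rewrite /quot_add unlock; apply/quot_projP; rewrite opprD addrACA; apply: ideal_add; apply: quot_reprK.
Qed.

Lemma quot_mulE x y :
  quot_mul (quot_proj x) (quot_proj y) = quot_proj (x * y).
Proof.
rewrite /quot_mul unlock; apply/quot_projP; set u := quot_repr _; set v := quot_repr _.
rewrite -(subrKA (x * v)) -mulrBl -mulrBr.
by apply: ideal_add; [apply: ideal_mulr | apply: ideal_mull]; apply: quot_reprK.
Qed.

Lemma quot_scaleE a x : quot_scale a (quot_proj x) = quot_proj (a *: x).
Proof.
rewrite /quot_scale unlock; apply/quot_projP; rewrite -scalerBr -mulr_algl.
exact/ideal_mull/quot_reprK.
Qed.

Lemma quot_algW (Q : quot_alg -> Prop) :
  (forall x, Q (quot_proj x)) -> forall u, Q u.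
Proof. by move=> Qp u; rewrite -(quot_projK u). Qed.

Lemma quot_addA : associative quot_add.
Proof.
elim/quot_algW=> x; elim/quot_algW=> y; elim/quot_algW=> z.
by rewrite !quot_addE addrA.
Qed.

Lemma quot_addC : commutative quot_add.
Proof.
elim/quot_algW=> x; elim/quot_algW=> y.
by rewrite !quot_addE addrC.
Qed.

Lemma quot_add0 : left_id quot_zero quot_add.
Proof. by elim/quot_algW=> x; rewrite quot_zeroE quot_addE add0r. Qed.

Lemma quot_addN : left_inverse quot_zero quot_opp quot_add.
Proof. by elim/quot_algW=> x; rewrite quot_zeroE quot_oppE quot_addE addNr. Qed.

HB.instance Definition _ := GRing.isZmodule.Build quot_alg
  quot_addA quot_addC quot_add0 quot_addN.

Lemma quot_mulA : associative quot_mul.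
Proof.
elim/quot_algW=> x; elim/quot_algW=> y; elim/quot_algW=> z.
by rewrite !quot_mulE mulrA.
Qed.

Lemma quot_mul1 : left_id quot_one quot_mul.
Proof. by elim/quot_algW=> x; rewrite quot_oneE quot_mulE mul1r. Qed.

Lemma quot_1mul : right_id quot_one quot_mul.
Proof. by elim/quot_algW=> x; rewrite quot_oneE quot_mulE mulr1. Qed.

Lemma quot_mulDl : left_distributive quot_mul quot_add.
Proof.
elim/quot_algW=> x; elim/quot_algW=> y; elim/quot_algW=> z.
by rewrite !(quot_mulE, quot_addE) mulrDl.
Qed.

Lemma quot_mulDr : right_distributive quot_mul quot_add.
Proof.
elim/quot_algW=> x; elim/quot_algW=> y; elim/quot_algW=> z.
by rewrite !(quot_mulE, quot_addE) mulrDr.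
Qed.

Lemma quot_1neq0 : quot_one != 0.
Proof.
apply/eqP; rewrite quot_oneE [0]quot_zeroE => /quot_projP.
by rewrite subr0; apply: S_proper.
Qed.

HB.instance Definition _ := GRing.Zmodule_isNzRing.Build quot_alg
  quot_mulA quot_mul1 quot_1mul quot_mulDl quot_mulDr quot_1neq0.

Lemma quot_scaleA a b u :
  quot_scale a (quot_scale b u) = quot_scale (a * b) u.
Proof.
by elim/quot_algW: u => x; rewrite !quot_scaleE scalerA.
Qed.

Lemma quot_scale1 : left_id 1 quot_scale.
Proof. by elim/quot_algW=> x; rewrite quot_scaleE scale1r. Qed.

Lemma quot_scaleDr : right_distributive quot_scale +%R.
Proof.
move=> a; elim/quot_algW=> x; elim/quot_algW=> y.
by rewrite [_ + _]quot_addE !quot_scaleE [RHS]quot_addE scalerDr.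
Qed.

Lemma quot_scaleDl u : {morph quot_scale^~ u : a b / a + b}.
Proof.
move=> a b; elim/quot_algW: u => x.
by rewrite !quot_scaleE [RHS]quot_addE scalerDl.
Qed.

HB.instance Definition _ := GRing.Zmodule_isLmodule.Build F quot_alg
  quot_scaleA quot_scale1 quot_scaleDr quot_scaleDl.

Lemma quot_proj_is_zmod_morphism : zmod_morphism quot_proj.
Proof. by move=> x y; rewrite [- quot_proj y]quot_oppE [RHS]quot_addE. Qed.

Lemma quot_proj_is_monoid_morphism : monoid_morphism quot_proj.
Proof. by split=> [|x y]; [exact/esym/quot_oneE | exact/esym/quot_mulE]. Qed.

HB.instance Definition _ := GRing.isZmodMorphism.Build V quot_alg
  quot_proj quot_proj_is_zmod_morphism.
HB.instance Definition _ := GRing.isMonoidMorphism.Build V quot_alg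
  quot_proj quot_proj_is_monoid_morphism.

Lemma quot_projZ (a : F) x : quot_proj (a *: x) = a *: quot_proj x.
Proof. by rewrite [RHS]quot_scaleE. Qed.

Lemma quot_scaleAl (a : F) (u v : quot_alg) : a *: (u * v) = a *: u * v.
Proof.
elim/quot_algW: u => x; elim/quot_algW: v => y.
by rewrite -rmorphM -!quot_projZ -rmorphM scalerAl.
Qed.

HB.instance Definition _ :=
  GRing.Lmodule_isLalgebra.Build F quot_alg quot_scaleAl.

Lemma quot_scaleAr (a : F) (u v : quot_alg) : a *: (u * v) = u * (a *: v).
Proof.
elim/quot_algW: u => x; elim/quot_algW: v => y.
by rewrite -rmorphM -!quot_projZ -rmorphM scalerAr.
Qed.

HB.instance Definition _ :=
  GRing.Lalgebra_isAlgebra.Build F quot_alg quot_scaleAr.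

HB.instance Definition _ := GRing.isScalable.Build F V quot_alg *:%R
  quot_proj quot_projZ.


Section Lift.
Context (W : algType F) (phi : {lrmorphism V -> W}).
Hypothesis phi_S : forall r, S r -> phi r = 0.

Lemma quot_lift_exists :
  exists psi : {lrmorphism quot_alg -> W}, forall x, psi (quot_proj x) = phi x.
Proof.
pose lift (u : quot_alg) : W := phi (quot_repr u).
have liftE x : lift (quot_proj x) = phi x.
  apply/eqP; rewrite -subr_eq0 -raddfB; apply/eqP.
  exact: ideal_kernel phi_S _ (quot_reprK x).
have lB : zmod_morphism lift.
  elim/quot_algW=> x; elim/quot_algW=> y.
  by rewrite -raddfB !liftE raddfB.
have lM : monoid_morphism lift.
  split; first by rewrite -(rmorph1 quot_proj) liftE rmorph1.
  elim/quot_algW=> x; elim/quot_algW=> y.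
  by rewrite -rmorphM !liftE rmorphM.
have lZ : scalable lift.
  move=> a; elim/quot_algW=> x.
  by rewrite -quot_projZ !liftE linearZ.
pose m1 := GRing.isZmodMorphism.Build _ _ lift lB.
pose m2 := GRing.isMonoidMorphism.Build _ _ lift lM.
pose m3 := GRing.isScalable.Build F _ _ *:%R lift lZ.
pose psi : {lrmorphism quot_alg -> W} := HB.pack lift m1 m2 m3.
by exists psi.
Qed.

End Lift.

End Quotient.

(* The universal property of the free algebra. *)
Section FreeEval.
Context (F : fieldType) (n : nat) (W : algType F) (f : 'I_n -> W).
Local Notation free := (free_alg F n).
Local Notation malg := {malg F[{fmonom 'I_n}]}.

Definition word_eval (m : {fmonom 'I_n}) : W :=
  \prod_(i <- (m : seq 'I_n)) f i.

Lemma word_eval_mmorphism : mmorphism word_eval.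
Proof.
by split=> [m1 m2|]; rewrite /word_eval ?fmM ?big_cat // fm1 big_nil.
Qed.

HB.instance Definition _ :=
  isMultiplicative.Build {fmonom 'I_n} W word_eval word_eval_mmorphism.

Definition free_eval (x : free) : W := mmap (in_alg W) word_eval (x : malg).

Lemma free_evalZ (a : F) (x : free) : free_eval (a *: x) = a *: free_eval x.
Proof.
by rewrite /free_eval [LHS](mmapZ (f := in_alg W)) /= mulr_algl.
Qed.

Lemma free_eval_is_zmod_morphism : zmod_morphism free_eval.
Proof.
move=> x y; have := raddfB (mmap (in_alg W) word_eval) (x : malg) (y : malg).
exact.
Qed.

Lemma free_eval_is_monoid_morphism : monoid_morphism free_eval.
Proof.
have [|? ?] := @commr_mmap_is_multiplicative _ F W (in_alg W) word_eval.
  by move=> g m m'; rewrite /GRing.comm /= mulr_algl mulr_algr.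
by split.
Qed.

HB.instance Definition _ := GRing.isZmodMorphism.Build free W free_eval
  free_eval_is_zmod_morphism.
HB.instance Definition _ := GRing.isMonoidMorphism.Build free W free_eval
  free_eval_is_monoid_morphism.
HB.instance Definition _ := GRing.isScalable.Build F free W *:%R free_eval
  free_evalZ.

Lemma free_eval_gen i : free_eval (free_gen F i) = f i.
Proof.
by rewrite /free_eval mmapU /= scale1r mul1r /word_eval fmU big_seq1.
Qed.

End FreeEval.

Lemma free_ind (F : fieldType) (n : nat) (Q : free_alg F n -> Prop) :
  (forall i, Q (free_gen F i)) -> Q 1 ->
  (forall x y, Q x -> Q y -> Q (x + y)) ->
  (forall x y, Q x -> Q y -> Q (x * y)) ->
  (forall a x, Q x -> Q (a *: x)) -> forall x, Q x.
Proof.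
move=> Qg Q1 QD QM QZ x; pose malg := {malg F[{fmonom 'I_n}]}.
have Q0 : Q 0 by rewrite -(scale0r 1); apply: QZ.
have Qw (s : seq 'I_n) : Q (<< FMonom s >> : malg).
  elim: s => [|i s IHs]; first by rewrite -fmoneE.
  have -> : << FMonom (i :: s) >> = << fmu i >> * << FMonom s >> :> malg.
    rewrite malgM_def fgmulUU mulr1.
    by congr << 1 *g _ >>; apply/eqP; rewrite fmP fmM fmU.
  by move: (QM _ _ (Qg i) IHs).
rewrite [x](monalgE (x : malg)); apply: (big_ind Q) => // -[s] _.
have -> : << x@_(FMonom s) *g FMonom s >>
    = x@_(FMonom s) *: << FMonom s >> :> malg.
  by rewrite -mul_malgC malgM_def fgmulUU mulr1 mul1m.
by move: (QZ x@_(FMonom s) _ (Qw s)).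
Qed.

Section PresentedAlgebra.
Context (F : fieldType) (n : nat) (S : free_alg F n -> Prop).
Context (S_proper : ~ two_sided_ideal S 1).

(* The algebra with n generators and relations r = 0 for all r in S. *)
Definition presented_alg : algType F := quot_alg_of S_proper.

Definition pres_gen (i : 'I_n) : presented_alg :=
  quot_proj S_proper (free_gen F i).

Lemma pres_relation r : S r -> quot_proj S_proper r = 0.
Proof.
move=> Sr; rewrite -(rmorph0 (quot_proj S_proper)); apply/quot_projP.
by rewrite subr0; apply: ideal_gen.
Qed.

Lemma pres_lift_exists (W : algType F) (f : 'I_n -> W) :
  (forall r, S r -> free_eval f r = 0) ->
  exists phi : {lrmorphism presented_alg -> W},
    forall i, phi (pres_gen i) = f i.
Proof.
move=> /(quot_lift_exists S_proper) [phi phiE]; exists phi => i.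
by rewrite [LHS]phiE [LHS]free_eval_gen.
Qed.

Lemma pres_lift_unique (W : algType F)
    (phi psi : {lrmorphism presented_alg -> W}) :
  (forall i, phi (pres_gen i) = psi (pres_gen i)) -> phi =1 psi.
Proof.
move=> eq_gen; elim/quot_algW; elim/free_ind => //.
- by rewrite !rmorph1.
- by move=> x y IHx IHy; rewrite !rmorphD /= IHx IHy.
- by move=> x y IHx IHy; rewrite !rmorphM /= IHx IHy.
- by move=> a x IHx; rewrite quot_projZ !linearZ /= IHx.
Qed.

End PresentedAlgebra.

(* An ideal is proper if its generators vanish at 0. *)
Lemma ideal_proper_of_eval0 (F : fieldType) (n : nat)
    (S : free_alg F n -> Prop) :
  (forall r, S r -> free_eval (W := F^o) (fun=> 0) r = 0) ->
  ~ two_sided_ideal S 1.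
Proof.
by move=> S0 /(ideal_kernel S0) /eqP; rewrite rmorph1 oner_eq0.
Qed.

Lemma rmorph_commutator0 (V : nzRingType) (W : comNzRingType)
    (phi : {rmorphism V -> W}) (x y : V) : phi (commutator x y) = 0.
Proof. by rewrite /commutator rmorphB !rmorphM mulrC subrr. Qed.

Lemma rmorph_commutatorB0 (V : nzRingType) (W : comNzRingType)
    (phi : {rmorphism V -> W}) (x y z : V) :
  phi z = 0 -> phi (commutator x y - 2 * z) = 0.
Proof.
by move=> z0; rewrite rmorphB rmorph_commutator0 rmorphM z0 mulr0 subrr.
Qed.

Section Racah.
Context (V : nzRingType) (A B C D : V).

Definition racah_alpha : V := commutator A D + A * C - B * A.
Definition racah_beta : V := commutator B D + B * A - C * B.
Definition racah_gamma : V := commutator C D + C * B - A * C.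

End Racah.

Section RacahAlgebra.
Context (F : fieldType).

Local Notation free := (free_alg F 4).
Local Notation a := (free_gen F (@Ordinal 4 0 isT)).
Local Notation b := (free_gen F (@Ordinal 4 1 isT)).
Local Notation c := (free_gen F (@Ordinal 4 2 isT)).
Local Notation d := (free_gen F (@Ordinal 4 3 isT)).

Inductive racah_relator : free -> Prop :=
| racah_relAB : racah_relator (commutator a b - 2 * d)
| racah_relBC : racah_relator (commutator b c - 2 * d)
| racah_relCA : racah_relator (commutator c a - 2 * d)
| racah_rel_alpha t : racah_relator (commutator (racah_alpha a b c d) t)
| racah_rel_beta t : racah_relator (commutator (racah_beta a b c d) t)
| racah_rel_gamma t : racah_relator (commutator (racah_gamma a b c d) t).

Lemma racah_relator_proper : ~ two_sided_ideal racah_relator 1.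
Proof.
apply: ideal_proper_of_eval0 => r.
pose e0 : {lrmorphism free -> F^o} := free_eval (W := F^o) (fun=> 0).
have comm0 x y : e0 (commutator x y) = 0 := rmorph_commutator0 e0 x y.
have rel0 x y i : e0 (commutator x y - 2 * free_gen F i) = 0.
  exact/rmorph_commutatorB0/free_eval_gen.
case=> [|||t|t|t]; [exact: rel0 | exact: rel0 | exact: rel0 | ..].
all: exact: comm0.
Qed.

Definition Racah : algType F := presented_alg racah_relator_proper.

Definition racah_A : Racah := pres_gen racah_relator_proper (@Ordinal 4 0 isT).
Definition racah_B : Racah := pres_gen racah_relator_proper (@Ordinal 4 1 isT).
Definition racah_C : Racah := pres_gen racah_relator_proper (@Ordinal 4 2 isT).
Definition racah_D : Racah := pres_gen racah_relator_proper (@Ordinal 4 3 isT).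

(* The sign of the last term matters: with B * (delta - alpha) in place of
   - B * (delta + alpha), Omega would satisfy [A, Omega] = 4 D delta <> 0
   instead of being central, and its image in the Bannai-Ito algebra would not
   commute with the image of A, as every polynomial in iota, kappa, lambda, mu
   does. *)
Definition is_casimir (Omega : Racah) : Prop :=
  let A := racah_A in let B := racah_B in
  let C := racah_C in let D := racah_D in
  let alpha := racah_alpha A B C D in
  let beta := racah_beta A B C D in
  let gamma := racah_gamma A B C D in
  let delta := A + B + C in
  exists2 c : Racah,
    generated_subalg [:: alpha; beta; gamma; delta] c
    & Omega = D ^+ 2 + A ^+ 2 + B ^+ 2
        + 2^-1 *: ((delta + 2) * anticommutator A B
                   - anticommutator (A ^+ 2) B - anticommutator A (B ^+ 2))
        + A * (beta - delta) - B * (delta + alpha) + c.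

End RacahAlgebra.

Section BannaiIto.
Context (V : nzRingType) (X Y Z : V).

Definition bi_kappa : V := anticommutator X Y - Z.
Definition bi_lambda : V := anticommutator Y Z - X.
Definition bi_mu : V := anticommutator Z X - Y.

End BannaiIto.

Section BannaiItoAlgebra.
Context (F : fieldType).

Local Notation free := (free_alg F 3).
Local Notation x := (free_gen F (@Ordinal 3 0 isT)).
Local Notation y := (free_gen F (@Ordinal 3 1 isT)).
Local Notation z := (free_gen F (@Ordinal 3 2 isT)).

Inductive bi_relator : free -> Prop :=
| bi_rel_kappa t : bi_relator (commutator (bi_kappa x y z) t)
| bi_rel_lambda t : bi_relator (commutator (bi_lambda x y z) t)
| bi_rel_mu t : bi_relator (commutator (bi_mu x y z) t).

Lemma bi_relator_proper : ~ two_sided_ideal bi_relator 1.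
Proof.
apply: ideal_proper_of_eval0 => r.
pose e0 : {lrmorphism free -> F^o} := free_eval (W := F^o) (fun=> 0).
by case=> t; exact: (rmorph_commutator0 e0).
Qed.

Definition BannaiIto : algType F := presented_alg bi_relator_proper.

Definition bi_X : BannaiIto := pres_gen bi_relator_proper (@Ordinal 3 0 isT).
Definition bi_Y : BannaiIto := pres_gen bi_relator_proper (@Ordinal 3 1 isT).
Definition bi_Z : BannaiIto := pres_gen bi_relator_proper (@Ordinal 3 2 isT).

End BannaiItoAlgebra.

(* Main.v *)
(* Existence.  Modulo the relations [Y X = - X Y + Z + kappa] and its two
   companions every element of the Bannai-Ito algebra can be written with X, Y,
   Z in this order over the central kappa, lambda, mu.  Comparing such normal
   forms expresses the images of alpha, beta, gamma, delta and of the base point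
   of the Casimir coset, up to powers of 2, as explicit integer polynomials in
   iota, kappa, lambda, mu.

   Uniqueness.  The Bannai-Ito algebra acts on sequences with values in a
   commutative ring K, with X upper and Y lower bidiagonal and with four free
   parameters p, q, r, t.  Then kappa, lambda, mu act as the scalars
   [2pq - r + t], [2qr - p - t], [2pr - q - t], and evaluation at 0 is an
   eigenfunctional of iota with eigenvalue [e = p + q + r], although iota is not
   central.  As [kappa + lambda = (2q - 1)(e - q)] and
   [kappa + mu = (2p - 1)(e - p)], completing the square reduces the algebraic
   independence of these four elements of K to that of monomials. *)

Require Import Defs.
From Stdlib Require Import BinInt.
From HB Require Import structures.
From mathcomp Require Import all_boot all_algebra boolp mpoly ssrZ ring.

Set Implicit Arguments.
Unset Strict Implicit.
Unset Printing Implicit Defensive.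

Import GRing.Theory.
Local Open Scope ring_scope.

(** * Normal ordering in the Bannai-Ito algebra *)

Inductive letter := Kappa | Lambda | Mu | LX | LY | LZ.

Definition letter_code (g : letter) : nat :=
  match g with
  | Kappa => 0 | Lambda => 1 | Mu => 2 | LX => 3 | LY => 4 | LZ => 5
  end.

Definition word := seq letter.
(** Plain lists with binary integer coefficients, so that normal forms can be computed by
    conversion. *)
Definition ncpoly := seq (Z * word).

Fixpoint same_word (v w : word) : bool :=
  match v, w with
  | [::], [::] => true
  | f :: v', g :: w' => eqn (letter_code f) (letter_code g) && same_word v' w'
  | _, _ => false
  end.

(** Terms that cancel are dropped, so that a vanishing difference can reduce to the empty list. *)
Fixpoint add_term (c : Z) (w : word) (p : ncpoly) : ncpoly :=
  if p is (d, v) :: p' then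
    if same_word w v then
      if Z.eqb (Z.add c d) Z.zero then p' else (Z.add c d, v) :: p'
    else (d, v) :: add_term c w p'
  else [:: (c, w)].

Definition addp (p q : ncpoly) : ncpoly :=
  foldr (fun t r => add_term t.1 t.2 r) q p.

Definition scalep (c : Z) (p : ncpoly) : ncpoly :=
  [seq (Z.mul c t.1, t.2) | t <- p].

(* [exchange f g = Some (h, c)] encodes the relation [g f = - f g + h + c]. *)
Definition exchange (f g : letter) : option (letter * letter) :=
  match f, g with
  | LX, LY => Some (LZ, Kappa)
  | LY, LZ => Some (LX, Lambda)
  | LX, LZ => Some (LY, Mu)
  | _, _ => None
  end.

(** The linear extension of [F] from words to polynomials. *)
Definition bindp (F : word -> ncpoly) (p : ncpoly) : ncpoly :=
  foldr (fun t => addp (scalep t.1 (F t.2))) [::] p.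

(* The normal form of [g w] for a word w in normal form; n is fuel, and the
   result is correct, if not normal, when it runs out. *)
Fixpoint mul_letter_word (n : nat) (g : letter) (w : word) : ncpoly :=
  match n, w with
  | n'.+1, f :: w' =>
    if exchange f g is Some (h, c) then
      addp (scalep (Z.opp Z.one)
              (bindp (mul_letter_word n' f) (mul_letter_word n' g w')))
           (add_term Z.one (c :: w') (mul_letter_word n' h w'))
    else if (letter_code f < 3)%N && (letter_code f < letter_code g)%N then
      bindp (mul_letter_word n' f) (mul_letter_word n' g w')
    else [:: (Z.one, g :: w)]
  | _, _ => [:: (Z.one, g :: w)]
  end.

Definition mul_letter (g : letter) : ncpoly -> ncpoly :=
  bindp (fun w => mul_letter_word (size w).*2.+1 g w).

Definition mulp (p q : ncpoly) : ncpoly :=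
  bindp (foldr mul_letter q) p.

Inductive ncexpr :=
| NCgen of letter
| NCconst of nat
| NCadd of ncexpr & ncexpr
| NCopp of ncexpr
| NCmul of ncexpr & ncexpr.

Fixpoint normal_form (e : ncexpr) : ncpoly :=
  match e with
  | NCgen g => [:: (Z.one, [:: g])]
  | NCconst n => [:: (Z.of_nat n, [::])]
  | NCadd e1 e2 => addp (normal_form e1) (normal_form e2)
  | NCopp e1 => scalep (Z.opp Z.one) (normal_form e1)
  | NCmul e1 e2 => mulp (normal_form e1) (normal_form e2)
  end.

(** * Soundness of the rewriting *)

Section Soundness.
Context (V : nzRingType) (X Y Z : V).
Hypothesis central_kappa : forall v, GRing.comm (bi_kappa X Y Z) v.
Hypothesis central_lambda : forall v, GRing.comm (bi_lambda X Y Z) v.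
Hypothesis central_mu : forall v, GRing.comm (bi_mu X Y Z) v.

Definition eval_letter (g : letter) : V :=
  match g with
  | Kappa => bi_kappa X Y Z | Lambda => bi_lambda X Y Z | Mu => bi_mu X Y Z
  | LX => X | LY => Y | LZ => Z
  end.

Definition eval_word (w : word) : V := \prod_(g <- w) eval_letter g.

Definition eval_ncpoly (p : ncpoly) : V :=
  \sum_(t <- p) (int_of_Z t.1)%:~R * eval_word t.2.

Fixpoint eval_ncexpr (e : ncexpr) : V :=
  match e with
  | NCgen g => eval_letter g
  | NCconst n => n%:R
  | NCadd e1 e2 => eval_ncexpr e1 + eval_ncexpr e2
  | NCopp e1 => - eval_ncexpr e1
  | NCmul e1 e2 => eval_ncexpr e1 * eval_ncexpr e2
  end.

Lemma eval_word_cons g w : eval_word (g :: w) = eval_letter g * eval_word w.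
Proof. exact: big_cons. Qed.

Lemma eval_ncpoly_nil : eval_ncpoly [::] = 0.
Proof. exact: big_nil. Qed.

Lemma eval_ncpoly_cons t p :
  eval_ncpoly (t :: p) = (int_of_Z t.1)%:~R * eval_word t.2 + eval_ncpoly p.
Proof. exact: big_cons. Qed.

Lemma eval_ncpoly1 w : eval_ncpoly [:: (Z.one, w)] = eval_word w.
Proof. by rewrite eval_ncpoly_cons eval_ncpoly_nil addr0 mul1r. Qed.

Lemma same_wordP v w : same_word v w -> v = w.
Proof.
elim: v w => [|f v IHv] [|g w] //= /andP[/eqnP fg /IHv ->].
by case: f g fg => -[].
Qed.

Lemma eval_add_term c w p :
  eval_ncpoly (add_term c w p)
  = (int_of_Z c)%:~R * eval_word w + eval_ncpoly p.
Proof.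
elim: p => [|[d v] p IHp] /=; first exact: eval_ncpoly_cons.
have intD :
    (int_of_Z (Z.add c d))%:~R = (int_of_Z c)%:~R + (int_of_Z d)%:~R :> V.
  by rewrite raddfD /= intrD.
case: ifP => [/same_wordP ->|_]; last first.
  by rewrite !eval_ncpoly_cons IHp addrCA.
rewrite eval_ncpoly_cons addrA -mulrDl -intD.
case: (Z.eqb_spec (Z.add c d) Z.zero) => [->|_]; last exact: eval_ncpoly_cons.
by rewrite mul0r add0r.
Qed.

Lemma eval_addp p q : eval_ncpoly (addp p q) = eval_ncpoly p + eval_ncpoly q.
Proof.
elim: p => [|t p IHp] /=; first by rewrite eval_ncpoly_nil add0r.
by rewrite eval_add_term IHp eval_ncpoly_cons addrA.
Qed.

Lemma eval_scalep c p :
  eval_ncpoly (scalep c p) = (int_of_Z c)%:~R * eval_ncpoly p.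
Proof.
rewrite /eval_ncpoly big_map mulr_sumr; apply: eq_bigr => t _ /=.
by rewrite (rmorphM int_of_Z) intrM mulrA.
Qed.

Lemma eval_bindp F u p : (forall w, eval_ncpoly (F w) = eval_word w * u) ->
  eval_ncpoly (bindp F p) = eval_ncpoly p * u.
Proof.
move=> FE; elim: p => [|t p IHp] /=; first by rewrite eval_ncpoly_nil mul0r.
by rewrite eval_addp eval_scalep IHp FE eval_ncpoly_cons mulrDl mulrA.
Qed.

Lemma eval_bindp_letter F v p :
  (forall w, eval_ncpoly (F w) = v * eval_word w) ->
  eval_ncpoly (bindp F p) = v * eval_ncpoly p.
Proof.
move=> FE; elim: p => [|t p IHp] /=; first by rewrite eval_ncpoly_nil mulr0.
rewrite eval_addp eval_scalep IHp FE eval_ncpoly_cons mulrDr.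
by rewrite !mulrzl mulrzAr.
Qed.

Lemma exchangeP f g h c : exchange f g = Some (h, c) ->
  eval_letter g * eval_letter f
  = - (eval_letter f * eval_letter g) + (eval_letter h + eval_letter c).
Proof.
have swap (a b d : V) : b * a = - (a * b) + (d + (a * b + b * a - d)).
  by rewrite [a * b + _ - d]addrC [d + _]addrA subrr add0r addKr.
(* [bi_mu] is {Z, X}: here the product to be reordered comes first in the anticommutator, unlike in
   [bi_kappa] and [bi_lambda]. *)
have swap' (a b d : V) : b * a = - (a * b) + (d + (b * a + a * b - d)).
  by rewrite [b * a + a * b]addrC -swap.
by case: f g => -[] //= [<- <-]; [exact: swap | exact: swap' | exact: swap].
Qed.

Lemma central_letter g v :
  (letter_code g < 3)%N -> GRing.comm (eval_letter g) v.
Proof. by case: g. Qed.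

(** Each branch applies an exchange relation, moves a central letter or leaves the product alone, so
    every fuel [n] will do. The induction is on [n] because the recursion also runs on words
    produced by inner calls. *)
Lemma eval_mul_letter_word n g w :
  eval_ncpoly (mul_letter_word n g w) = eval_letter g * eval_word w.
Proof.
elim: n g w => [|n IHn] g [|f w] /=; rewrite ?eval_ncpoly1 ?eval_word_cons //.
case E : exchange => [[h c]|].
  rewrite eval_addp eval_add_term eval_scalep (eval_bindp_letter _ (IHn f)).
  rewrite !IHn [RHS]mulrA (exchangeP E) !mulrDl mulN1r mulNr mul1r.
  rewrite -[in RHS]mulrA.
  by rewrite eval_word_cons [_ * _ + _ * _ in LHS]addrC.
case: ifP => [/andP[/central_letter fC _]|_]; last first.
  by rewrite eval_ncpoly1 !eval_word_cons.
by rewrite (eval_bindp_letter _ (IHn f)) IHn !mulrA fC.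
Qed.

Lemma eval_mul_letter g p :
  eval_ncpoly (mul_letter g p) = eval_letter g * eval_ncpoly p.
Proof. by apply: eval_bindp_letter => w; apply: eval_mul_letter_word. Qed.

Lemma eval_mulp p q : eval_ncpoly (mulp p q) = eval_ncpoly p * eval_ncpoly q.
Proof.
apply: eval_bindp => w; elim: w => [|g w IHw] /=.
  by rewrite /eval_word big_nil mul1r.
by rewrite eval_mul_letter IHw eval_word_cons mulrA.
Qed.

Lemma eval_normal_form e : eval_ncpoly (normal_form e) = eval_ncexpr e.
Proof.
elim: e => [g|n|e1 IH1 e2 IH2|e IHe|e1 IH1 e2 IH2] /=.
- by rewrite eval_ncpoly1 eval_word_cons /eval_word big_nil mulr1.
- rewrite eval_ncpoly_cons eval_ncpoly_nil addr0 /eval_word big_nil mulr1 /=.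
  by case: n => //= n; rewrite SuccNat2Pos.id_succ.
- by rewrite eval_addp IH1 IH2.
- by rewrite eval_scalep IHe mulN1r.
- by rewrite eval_mulp IH1 IH2.
Qed.

(** Reflection: the premise involves no ring element, so plain evaluation settles it. *)
Lemma ncexpr_eq e1 e2 :
  nilp (normal_form (NCadd e1 (NCopp e2))) -> eval_ncexpr e1 = eval_ncexpr e2.
Proof.
move/nilP => nf0; apply/eqP; rewrite -subr_eq0.
by rewrite -[_ - _]/(eval_ncexpr (NCadd e1 (NCopp e2))) -eval_normal_form nf0
   eval_ncpoly_nil.
Qed.

End Soundness.

(** * Deciding identities by evaluation *)

Ltac reify X Y Z t :=
  lazymatch t with
  | X => constr:(NCgen LX)
  | Y => constr:(NCgen LY)
  | Z => constr:(NCgen LZ)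
  | bi_kappa X Y Z => constr:(NCgen Kappa)
  | bi_lambda X Y Z => constr:(NCgen Lambda)
  | bi_mu X Y Z => constr:(NCgen Mu)
  | 1 => constr:(NCconst 1)
  | ?n%:R => constr:(NCconst n)
  | ?a + ?b =>
    let a' := reify X Y Z a in let b' := reify X Y Z b in constr:(NCadd a' b')
  | ?a * ?b =>
    let a' := reify X Y Z a in let b' := reify X Y Z b in constr:(NCmul a' b')
  | ?a ^+ 2 => let a' := reify X Y Z a in constr:(NCmul a' a')
  | - ?a => let a' := reify X Y Z a in constr:(NCopp a')
  end.

Ltac normal_ordering hk hl hm :=
  lazymatch type of hk with
  | forall v, GRing.comm (bi_kappa ?X ?Y ?Z) v =>
    lazymatch goal with
    | |- ?a = ?b =>
      let a' := reify X Y Z a in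
      let b' := reify X Y Z b in
      exact: (@ncexpr_eq _ X Y Z hk hl hm a' b' (erefl true))
    end
  end.

(* 8192 times the image of the base point of the Casimir coset. *)
Definition bi_casimir_poly (V : nzRingType) (i k l m : V) : V :=
  let n := l + m in
  - (96 * (i ^+ 2) ^+ 2) + (384 - 64 * k) * (i * i ^+ 2)
  + (240 + 192 * n + 416 * k + 32 * k ^+ 2) * i ^+ 2
  + (96 * (k * n) + 32 * (l * m) - 1248 - 320 * n - 624 * k) * i
  - (630 + 720 * n + 552 * k + 128 * n ^+ 2 + 48 * (l * m) + 400 * (k * n)
     + 168 * k ^+ 2 + 32 * (k * (l * m)) + 32 * (k ^+ 2 * n)
     + 32 * (k * k ^+ 2)).

(** * The integer identities behind alpha, beta, gamma, delta and the Casimir element *)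

Section Identities.
Context (V : nzRingType) (X Y Z : V).
Hypothesis central_kappa : forall v, GRing.comm (bi_kappa X Y Z) v.
Hypothesis central_lambda : forall v, GRing.comm (bi_lambda X Y Z) v.
Hypothesis central_mu : forall v, GRing.comm (bi_mu X Y Z) v.

Let a := (2 * X - 3) * (2 * X + 1).
Let b := (2 * Y - 3) * (2 * Y + 1).
Let c := (2 * Z - 3) * (2 * Z + 1).
(* As a, b, c are 16 times the images of A, B, C, this is 32 times that of D. *)
Let d := commutator (X * X - X) (Y * Y - Y).
Let i := X + Y + Z.
Let k := bi_kappa X Y Z.
Let l := bi_lambda X Y Z.
Let m := bi_mu X Y Z.

(** As [a] equals 4 (X^2 - X) - 3, and similarly for [b], the constants drop out of the
    commutator. *)
Lemma bi_commutator_AB : commutator a b = 16 * d.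
Proof.
rewrite /a /b /d /commutator.
normal_ordering central_kappa central_lambda central_mu.
Qed.

(** The factor 2 evens out the scales: [a], [b], [c] carry 2^4 and [d] carries 2^5, so the left side
    is 2^9 times the image of alpha. *)
Lemma bi_alphaE :
  commutator a d + 2 * (a * c - b * a)
  = 8 * ((m - k) * (m + k + 3 - 2 * i)).
Proof.
rewrite /a /b /c /d /commutator /i /m /k.
normal_ordering central_kappa central_lambda central_mu.
Qed.

Lemma bi_betaE :
  commutator b d + 2 * (b * a - c * b)
  = 8 * ((k - l) * (k + l + 3 - 2 * i)).
Proof.
rewrite /a /b /c /d /commutator /i /l /k.
normal_ordering central_kappa central_lambda central_mu.
Qed.

Lemma bi_gammaE :
  commutator c d + 2 * (c * b - a * c)
  = 8 * ((l - m) * (l + m + 3 - 2 * i)).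
Proof.
rewrite /a /b /c /d /commutator /i /l /m.
normal_ordering central_kappa central_lambda central_mu.
Qed.

(** The square of [i] is X^2 + Y^2 + Z^2 plus the three anticommutators, which sum to
    [k + l + m + i]. *)
Lemma bi_deltaE : a + b + c = 4 * i ^+ 2 - 8 * i - 4 * (k + l + m) - 9.
Proof.
rewrite /a /b /c /i /l /k /m.
normal_ordering central_kappa central_lambda central_mu.
Qed.

Let dl := 4 * i ^+ 2 - 8 * i - 4 * (k + l + m) - 9.
Let al := 8 * ((m - k) * (m + k + 3 - 2 * i)).
Let be := 8 * ((k - l) * (k + l + 3 - 2 * i)).

(** The left side is 2^13 times the image of the base point, with alpha, beta and delta replaced by
    the values found above. The terms that the coset halves appear with the factor 2^12. *)
Lemma bi_casimirE :
  8 * d ^+ 2 + 32 * (a ^+ 2 + b ^+ 2) + (dl + 32) * anticommutator a b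
  - anticommutator (a ^+ 2) b - anticommutator a (b ^+ 2)
  + a * (be - 32 * dl) - b * (32 * dl + al)
  = bi_casimir_poly i k l m.
Proof.
rewrite /bi_casimir_poly /a /b /be /al /dl /d /i /k /l /m.
rewrite /anticommutator /commutator.
normal_ordering central_kappa central_lambda central_mu.
Qed.

End Identities.

Lemma rmorph_commutator (V W : nzRingType) (g : {rmorphism V -> W}) (x y : V) :
  g (commutator x y) = commutator (g x) (g y).
Proof. by rewrite /commutator rmorphB !rmorphM. Qed.

Lemma rmorph_anticommutator (V W : nzRingType) (g : {rmorphism V -> W})
    (x y : V) :
  g (anticommutator x y) = anticommutator (g x) (g y).
Proof. by rewrite /anticommutator rmorphD !rmorphM. Qed.

Lemma rmorph_anticommutatorB (V W : nzRingType) (g : {rmorphism V -> W})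
    (x y z : V) :
  g (anticommutator x y - z) = anticommutator (g x) (g y) - g z.
Proof. by rewrite rmorphB rmorph_anticommutator. Qed.

Lemma rmorph_commutator_bi (V W : nzRingType) (g : {rmorphism V -> W})
    (x y z v : V) :
  g (commutator (anticommutator x y - z) v)
  = commutator (anticommutator (g x) (g y) - g z) (g v).
Proof. by rewrite rmorph_commutator rmorph_anticommutatorB. Qed.

(** * A module over the Bannai-Ito algebra with four parameters *)

Section SequenceOperators.
Context (F : fieldType) (K : comAlgType F).

(* Linearity over K, and not only over F, makes the scalars of K central. *)
Definition seq_linear (T : (nat -> K) -> nat -> K) : Prop :=
  forall c f g n, T (fun i => c * f i + g i) n = c * T f n + T g n.

(** Linearity is bundled with the map because right distributivity of composition depends on it. *)
Record seq_op := SeqOp {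
  seq_op_fun :> (nat -> K) -> nat -> K;
  seq_opP : seq_linear seq_op_fun }.

HB.instance Definition _ := gen_eqMixin seq_op.
HB.instance Definition _ := gen_choiceMixin seq_op.

Lemma seq_op_ext (S T : seq_op) : (forall f n, S f n = T f n) -> S = T.
Proof.
case: S T => [S Slin] [T Tlin] /= eqST.
have {}eqST : S = T by apply: funext => f; apply: funext => n.
by rewrite -eqST in Tlin *; congr SeqOp; apply: Prop_irrelevance.
Qed.

Lemma seq_opD (T : seq_op) f g n : T (fun i => f i + g i) n = T f n + T g n.
Proof.
rewrite -[T f n]mul1r -seq_opP; congr (T _ n).
by apply: funext => i; rewrite mul1r.
Qed.

Lemma seq_op0 (T : seq_op) n : T (fun=> 0) n = 0.
Proof.
by apply: (addrI (T (fun=> 0) n)); rewrite -seq_opD !addr0.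
Qed.

Lemma seq_opZ (T : seq_op) c f n : T (fun i => c * f i) n = c * T f n.
Proof.
rewrite -[RHS]addr0 -(seq_op0 T n) -seq_opP; congr (T _ n).
by apply: funext => i; rewrite addr0.
Qed.

Fact seq_op_zero_subproof : seq_linear (fun _ _ => 0).
Proof. by move=> c f g n; rewrite mulr0 addr0. Qed.
Definition seq_op_zero := SeqOp seq_op_zero_subproof.

Fact seq_op_scalar_subproof (c : K) : seq_linear (fun f n => c * f n).
Proof. by move=> a f g n; ring. Qed.
Definition seq_op_scalar c := SeqOp (seq_op_scalar_subproof c).

Fact seq_op_opp_subproof (T : seq_op) : seq_linear (fun f n => - T f n).
Proof. by move=> c f g n; rewrite seq_opP opprD mulrN. Qed.
Definition seq_op_opp T := SeqOp (seq_op_opp_subproof T).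

Fact seq_op_add_subproof (S T : seq_op) :
  seq_linear (fun f n => S f n + T f n).
Proof. by move=> c f g n; rewrite !seq_opP mulrDr addrACA. Qed.
Definition seq_op_add S T := SeqOp (seq_op_add_subproof S T).

Fact seq_op_mul_subproof (S T : seq_op) : seq_linear (fun f => S (T f)).
Proof.
move=> c f g n; rewrite -seq_opP; congr (S _ n).
by apply: funext => i; rewrite seq_opP.
Qed.
Definition seq_op_mul S T := SeqOp (seq_op_mul_subproof S T).

Fact seq_op_scale_subproof (a : F) (T : seq_op) :
  seq_linear (fun f n => a *: T f n).
Proof. by move=> c f g n; rewrite seq_opP scalerDr scalerAr. Qed.
Definition seq_op_scale a T := SeqOp (seq_op_scale_subproof a T).

Fact seq_op_addA : associative seq_op_add.
Proof. by move=> S T U; apply: seq_op_ext => f n /=; rewrite addrA. Qed.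
Fact seq_op_addC : commutative seq_op_add.
Proof. by move=> S T; apply: seq_op_ext => f n /=; rewrite addrC. Qed.
Fact seq_op_add0 : left_id seq_op_zero seq_op_add.
Proof. by move=> S; apply: seq_op_ext => f n /=; rewrite add0r. Qed.
Fact seq_op_addN : left_inverse seq_op_zero seq_op_opp seq_op_add.
Proof. by move=> S; apply: seq_op_ext => f n /=; rewrite addNr. Qed.

HB.instance Definition _ := GRing.isZmodule.Build seq_op
  seq_op_addA seq_op_addC seq_op_add0 seq_op_addN.

Fact seq_op_mulA : associative seq_op_mul.
Proof. by move=> S T U; apply: seq_op_ext. Qed.
Fact seq_op_mul1 : left_id (seq_op_scalar 1) seq_op_mul.
Proof. by move=> S; apply: seq_op_ext => f n /=; rewrite mul1r. Qed.
Fact seq_op_1mul : right_id (seq_op_scalar 1) seq_op_mul.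
Proof.
move=> S; apply: seq_op_ext => f n /=; congr (S _ n).
by apply: funext => i; rewrite mul1r.
Qed.
Fact seq_op_mulDl : left_distributive seq_op_mul seq_op_add.
Proof. by move=> S T U; apply: seq_op_ext. Qed.
Fact seq_op_mulDr : right_distributive seq_op_mul seq_op_add.
Proof. by move=> S T U; apply: seq_op_ext => f n /=; rewrite seq_opD. Qed.
Fact seq_op_1neq0 : seq_op_scalar 1 != 0.
Proof.
apply/eqP => /(congr1 (fun T : seq_op => T (fun=> 1) 0%N)) /= /eqP.
by rewrite mulr1 oner_eq0.
Qed.

HB.instance Definition _ := GRing.Zmodule_isNzRing.Build seq_op
  seq_op_mulA seq_op_mul1 seq_op_1mul seq_op_mulDl seq_op_mulDr seq_op_1neq0.

Fact seq_op_scaleA a b T :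
  seq_op_scale a (seq_op_scale b T) = seq_op_scale (a * b) T.
Proof. by apply: seq_op_ext => f n /=; rewrite scalerA. Qed.
Fact seq_op_scale1 : left_id 1 seq_op_scale.
Proof. by move=> S; apply: seq_op_ext => f n /=; rewrite scale1r. Qed.
Fact seq_op_scaleDr : right_distributive seq_op_scale +%R.
Proof. by move=> a S T; apply: seq_op_ext => f n /=; rewrite scalerDr. Qed.
Fact seq_op_scaleDl T : {morph seq_op_scale^~ T : a b / a + b}.
Proof. by move=> a b; apply: seq_op_ext => f n /=; rewrite scalerDl. Qed.

HB.instance Definition _ := GRing.Zmodule_isLmodule.Build F seq_op
  seq_op_scaleA seq_op_scale1 seq_op_scaleDr seq_op_scaleDl.

Fact seq_op_scaleAl (a : F) (S T : seq_op) : a *: (S * T) = a *: S * T.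
Proof. by apply: seq_op_ext => f n. Qed.

HB.instance Definition _ :=
  GRing.Lmodule_isLalgebra.Build F seq_op seq_op_scaleAl.

Fact seq_op_scaleAr (a : F) (S T : seq_op) : a *: (S * T) = S * (a *: T).
Proof.
apply: seq_op_ext => f n; rewrite /= -mulr_algl -seq_opZ; congr (S _ n).
by apply: funext => i; rewrite mulr_algl.
Qed.

HB.instance Definition _ :=
  GRing.Lalgebra_isAlgebra.Build F seq_op seq_op_scaleAr.

Lemma seq_op_scalar_comm c T : commutator (seq_op_scalar c) T = 0.
Proof.
by apply: seq_op_ext => f n; apply/eqP; rewrite subr_eq0 /= seq_opZ.
Qed.

Section BannaiItoModule.
Context (p q r t : K).

(* The weights forced by the relations and by [bi_phi 0 = 0], which makes the
   junk value [f 0.-1 = f 0] harmless below. *)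
Definition bi_phi (n : nat) : K :=
  let j := n./2%:R in
  if odd n then t - j * (2 * (p + q - r) + 4 * j + 1)
  else - (j * (2 * (p + q + r) + 4 * j - 1)).

Definition bi_seq_X (f : nat -> K) (n : nat) : K :=
  (-1) ^+ n * (p + n%:R) * f n + f n.+1.

Definition bi_seq_Y (f : nat -> K) (n : nat) : K :=
  (-1) ^+ n * (q + n%:R) * f n + bi_phi n * f n.-1.

(** The off-diagonal part is that of {X, Y}, so that [bi_kappa] can act as a scalar; the diagonal
    alternates between [r] and [- r - 1]. *)
Definition bi_seq_Z (f : nat -> K) (n : nat) : K :=
  (if odd n then - r - 1 else r) * f n
  + (-1) ^+ n * (bi_phi n * f n.-1 - f n.+1).

Fact bi_seq_X_linear : seq_linear bi_seq_X.
Proof. by move=> c f g n; rewrite /bi_seq_X; ring. Qed.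
Fact bi_seq_Y_linear : seq_linear bi_seq_Y.
Proof. by move=> c f g n; rewrite /bi_seq_Y; ring. Qed.
Fact bi_seq_Z_linear : seq_linear bi_seq_Z.
Proof. by move=> c f g n; rewrite /bi_seq_Z; ring. Qed.

Let X := SeqOp bi_seq_X_linear.
Let Y := SeqOp bi_seq_Y_linear.
Let Z := SeqOp bi_seq_Z_linear.

Lemma bi_phi_double j :
  bi_phi j.*2 = - (j%:R * (2 * (p + q + r) + 4 * j%:R - 1)).
Proof. by rewrite /bi_phi odd_double doubleK. Qed.

Lemma bi_phi_doubleS j :
  bi_phi j.*2.+1 = t - j%:R * (2 * (p + q - r) + 4 * j%:R + 1).
Proof. by rewrite /bi_phi /= odd_double uphalf_double. Qed.

Lemma bi_phi0 : bi_phi 0 = 0.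
Proof. by rewrite -[0%N]double0 bi_phi_double mul0r oppr0. Qed.

Lemma bi_phi1 : bi_phi 1 = t.
Proof. by rewrite -[1%N]/(0.*2.+1) bi_phi_doubleS mul0r subr0. Qed.

(** The index 0 is kept apart from the positive even ones because only for the latter is [n.-1] a
    true predecessor. *)
Lemma parity_ind (P : nat -> Prop) :
  P 0 -> (forall j, P j.*2.+1) -> (forall j, P j.*2.+2) -> forall n, P n.
Proof.
move=> P0 Podd Peven n; rewrite -(odd_double_half n).
case: (odd n); first exact: Podd.
by case: n./2 => [|j]; [exact: P0 | exact: Peven].
Qed.

Lemma signr_double j : (-1) ^+ j.*2 = 1 :> K.
Proof. by rewrite -signr_odd odd_double. Qed.

Lemma natr_double j : j.*2%:R = 2 * j%:R :> K.
Proof. by rewrite -mul2n natrM. Qed.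

(** [j.+1.*2] computes to [j.*2.+2], the shape in which shifted arguments of [bi_phi] occur. *)
Let bi_phi_doubleSS j : bi_phi j.*2.+2 = _ := bi_phi_double j.+1.
Let bi_phi_doubleSSS j : bi_phi j.*2.+3 = _ := bi_phi_doubleS j.+1.
Let parityE := (signr_double, exprS, bi_phi_doubleSSS, bi_phi_doubleSS,
  bi_phi_doubleS, bi_phi_double, bi_phi1, bi_phi0, odd_double).
Let natE := (mulrS, natr_double).

Ltac check_relation :=
  apply: seq_op_ext => f; apply: parity_ind => [|j|j];
  rewrite /= /bi_seq_X /bi_seq_Y /bi_seq_Z /= ?parityE /= ?natE; ring.

Lemma bi_seq_kappa : bi_kappa X Y Z = seq_op_scalar (2 * p * q - r + t).
Proof. check_relation. Qed.

Lemma bi_seq_lambda : bi_lambda X Y Z = seq_op_scalar (2 * q * r - p - t).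
Proof. check_relation. Qed.

Lemma bi_seq_mu : bi_mu X Y Z = seq_op_scalar (2 * p * r - q - t).
Proof. check_relation. Qed.

Lemma bi_seq_op_exists :
  exists phi : {lrmorphism BannaiIto F -> seq_op},
    [/\ phi (bi_X F) = X, phi (bi_Y F) = Y & phi (bi_Z F) = Z].
Proof.
pose gen := tnth [tuple X; Y; Z].
have [|phi phiE] :=
  @pres_lift_exists F 3 _ (@bi_relator_proper F) _ gen; last first.
  by exists phi; split; apply: phiE.
pose ev : {rmorphism free_alg F 3 -> seq_op} := free_eval gen.
have genE i : ev (free_gen F i) = gen i by apply: free_eval_gen.
move=> _ [] w; apply: etrans (rmorph_commutator_bi ev _ _ _ _) _;
  rewrite !genE.
- by rewrite [_ - _]bi_seq_kappa seq_op_scalar_comm.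
- by rewrite [_ - _]bi_seq_lambda seq_op_scalar_comm.
- by rewrite [_ - _]bi_seq_mu seq_op_scalar_comm.
Qed.

(** At index 0 the terms [f 1] of X and Z cancel, and [bi_phi 0 = 0] removes the lower ones. *)
Lemma bi_seq_iota f : (X + Y + Z) f 0%N = (p + q + r) * f 0%N.
Proof.
by rewrite /= /bi_seq_X /bi_seq_Y /bi_seq_Z /= bi_phi0 expr0; ring.
Qed.

(** The elements that act as a scalar after evaluation at 0 are closed under sums and products, the
    scalars following along. Hence a polynomial relation between the four elements passes to their
    scalars. *)
Lemma bi_mmap_specialize (P : {mpoly F[4]}) :
  let X := bi_X F in
  let Y := bi_Y F in
  let Z := bi_Z F in
  mmap (in_alg (BannaiIto F))
    (tnth [tuple X + Y + Z; bi_kappa X Y Z; bi_lambda X Y Z; bi_mu X Y Z]) P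
    = 0 ->
  mmap (in_alg K)
    (tnth [tuple p + q + r; 2 * p * q - r + t; 2 * q * r - p - t;
                 2 * p * r - q - t]) P = 0.
Proof.
have [phi [phiX phiY phiZ]] := bi_seq_op_exists.
cbv zeta; set u := tnth _; set v := tnth _.
(* iota does not act as a scalar, but it preserves the kernel of f |-> f 0. *)
pose acts (x : BannaiIto F) (c : K) := forall f, phi x f 0%N = c * f 0%N.
have actsM x y c d : acts x c -> acts y d -> acts (x * y) (c * d).
  by move=> xc yd f; rewrite rmorphM /= xc yd mulrA.
have acts1 : acts 1 1 by move=> f; rewrite rmorph1 /=.
have actsuv j : acts (u j) (v j).
  move=> f; case: j => -[|[|[|[|//]]]] lt_j; rewrite /u /v !(tnth_nth 0) /=.
  - by rewrite -bi_seq_iota rmorphD rmorphD /= phiX phiY phiZ.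
  - suff -> : phi (bi_kappa (bi_X F) (bi_Y F) (bi_Z F)) = bi_kappa X Y Z.
      by rewrite bi_seq_kappa.
    by rewrite [LHS]rmorph_anticommutatorB /= phiX phiY phiZ.
  - suff -> : phi (bi_lambda (bi_X F) (bi_Y F) (bi_Z F)) = bi_lambda X Y Z.
      by rewrite bi_seq_lambda.
    by rewrite [LHS]rmorph_anticommutatorB /= phiX phiY phiZ.
  - suff -> : phi (bi_mu (bi_X F) (bi_Y F) (bi_Z F)) = bi_mu X Y Z.
      by rewrite bi_seq_mu.
    by rewrite [LHS]rmorph_anticommutatorB /= phiX phiY phiZ.
have actsX i k : acts (u i ^+ k) (v i ^+ k).
  by elim: k => [|k IHk]; rewrite ?expr0 // !exprS; apply: actsM.
have actsA a : acts a%:A a%:A.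
  by move=> f; rewrite linearZ rmorph1 /= mul1r mulr_algl.
have actsP : acts (mmap (in_alg _) u P) (mmap (in_alg K) v P).
  rewrite /mmap; apply: (big_rec2 acts) => [f|m x c _ xc f].
    by rewrite raddf0 mul0r.
  rewrite raddfD mulrDl -xc; congr (_ + _).
  apply: (actsM _ _ _ _ (actsA _)).
  by apply: (big_rec2 acts) => // i y d _ yd; apply: actsM.
(* The constant sequence 1 reads off the scalar. *)
move=> P0; have := actsP (fun=> 1).
by rewrite P0 raddf0 mulr1 => <-.
Qed.

End BannaiItoModule.
End SequenceOperators.

(** * Algebraic independence *)

(** Scaling the exponents by [d] is injective on monomials, so each coefficient of [P] survives as a
    coefficient of the image. *)
Lemma mmap_expand_eq0 (F : fieldType) (n : nat) (d : 'I_n -> nat)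
    (P : {mpoly F[n]}) :
  (forall i, 0 < d i)%N ->
  mmap (in_alg {mpoly F[n]}) (fun i => 'X_i ^+ d i) P = 0 -> P = 0.
Proof.
move=> d_gt0 P0; apply/mpolyP => m0; rewrite mcoeff0.
pose D (m : 'X_{1..n}) := [multinom (d i * m i)%N | i < n].
have D_inj : injective D.
  move=> m1 m2 /mnmP eqD; apply/mnmP => i; move: (eqD i); rewrite !mnmE.
  by move/eqP; rewrite eqn_pmul2l // => /eqP.
have mmap1E m : mmap1 (fun i => 'X_i ^+ d i) m = 'X_[D m] :> {mpoly F[n]}.
  rewrite mpolyXE_id; apply: eq_bigr => i _.
  by rewrite -exprM mnmE.
have := congr1 (mcoeff (D m0)) P0; rewrite mcoeff0 /mmap raddf_sum /= => coef0.
rewrite [P]mpolyE raddf_sum /= -[RHS]coef0; apply: eq_bigr => m _.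
by rewrite mmap1E mulr_algl !mcoeffZ !mcoeffX (inj_eq D_inj).
Qed.

Lemma rmorph_mmap (F : fieldType) (n : nat) (K L : comAlgType F)
    (g : {rmorphism K -> L}) (h : 'I_n -> K) P :
  scalable g ->
  g (mmap (in_alg K) h P) = mmap (in_alg L) (g \o h) P.
Proof.
move=> gZ; rewrite /mmap rmorph_sum; apply: eq_bigr => m _.
rewrite rmorphM /= gZ rmorph1 /mmap1 rmorph_prod; congr (_ * _).
by apply: eq_bigr => i _; rewrite rmorphXn.
Qed.

Lemma mul_cube_half (R : comNzRingType) (c x : R) :
  2 * c = 1 -> c ^+ 3 * (8 * x) = x.
Proof.
move=> c2; have -> : c ^+ 3 * (8 * x) = (2 * c) ^+ 3 * x by ring.
by rewrite c2 expr1n mul1r.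
Qed.

(** With [w = 4 q - 2 e - 1] the difference of squares factors as (4 e - 4 q) (4 q - 2), which is 8
    times the right side. *)
Lemma half_quadratic (R : comNzRingType) (c e w : R) : 2 * c = 1 ->
  let q := c ^+ 2 * (w + 2 * e + 1) in
  c ^+ 3 * ((2 * e - 1) ^+ 2 - w ^+ 2) = (2 * q - 1) * (e - q).
Proof.
move=> c2 q.
have wE : w = 4 * q - 2 * e - 1.
  have -> : 4 * q = (2 * c) ^+ 2 * (w + 2 * e + 1) by rewrite /q; ring.
  by rewrite c2; ring.
move: q wE => q ->; rewrite -[RHS](mul_cube_half _ c2); congr (_ * _).
by ring.
Qed.

(** The substitution is an invertible one, affine in [u] and [v], followed by squaring [u] and [v].
    The latter is injective by [mmap_expand_eq0]. *)
Lemma quadratic_mmap_eq0 (F : fieldType) (P : {mpoly F[4]}) : 2 != 0 :> F ->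
  let c : {mpoly F[4]} := (2^-1)%:A in
  let E : {mpoly F[4]} := 'X_(@Ordinal 4 0 isT) in
  let K := 'X_(@Ordinal 4 1 isT) in
  let u := 'X_(@Ordinal 4 2 isT) in
  let v := 'X_(@Ordinal 4 3 isT) in
  mmap (in_alg {mpoly F[4]})
    (tnth [tuple E; K; c ^+ 3 * ((2 * E - 1) ^+ 2 - u ^+ 2) - K;
                       c ^+ 3 * ((2 * E - 1) ^+ 2 - v ^+ 2) - K]) P = 0 ->
  P = 0.
Proof.
move=> two_neq0 c E K u v P0.
have c2 : 2 * c = 1 by rewrite mulr_natl -scaler_nat scalerA divff // scale1r.
pose ev (h : 'I_4 -> {mpoly F[4]}) :
  {rmorphism {mpoly F[4]} -> {mpoly F[4]}} := mmap (in_alg {mpoly F[4]}) h.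
have evZ h : scalable (ev h) by move=> a Q; rewrite [LHS]mmapZ /= mulr_algl.
have evX h i : ev h 'X_i = h i by rewrite [LHS]mmapX mmap1U.
have evc h : ev h c = c by rewrite evZ rmorph1.
have ev_comp h g Q : ev h (ev g Q) = ev (ev h \o g) Q by apply: rmorph_mmap.
have ev_id Q : ev (fun i => 'X_i) Q = Q.
  rewrite [RHS]mpolyE; apply: eq_bigr => m _.
  by rewrite mmap1_id /= mulr_algl.
pose sq (i : 'I_4) : {mpoly F[4]} := 'X_i ^+ (if (i < 2)%N then 1 else 2).
pose L := tnth [tuple E; K; c ^+ 3 * ((2 * E - 1) ^+ 2 - u) - K;
                c ^+ 3 * ((2 * E - 1) ^+ 2 - v) - K].
(* M inverts the substitution L. *)
pose M := tnth [tuple E; K; (2 * E - 1) ^+ 2 - 8 * (u + K);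
                (2 * E - 1) ^+ 2 - 8 * (v + K)].
have ord4 (Q : 'I_4 -> Prop) : Q (@Ordinal 4 0 isT) -> Q (@Ordinal 4 1 isT) ->
    Q (@Ordinal 4 2 isT) -> Q (@Ordinal 4 3 isT) -> forall i, Q i.
  move=> Q0 Q1 Q2 Q3 [[|[|[|[|//]]]] lt_i];
  by rewrite (bool_irrelevance lt_i isT).
have evE :=
  (rmorphB, rmorphD, rmorphM, rmorphXn, rmorph_nat, rmorph1, evX, evc).
have sqL : ev sq (ev L P) = 0.
  rewrite ev_comp -[RHS]P0; congr (mmap _ _ P); apply: funext.
  by apply: ord4; rewrite /= /L !(tnth_nth 0) /= ?evE.
have LP0 : ev L P = 0.
  apply: (mmap_expand_eq0 (d := fun i => if (i < 2)%N then 1 else 2)) sqL => i.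
  by case: ifP.
have <- : ev M (ev L P) = P; last by rewrite LP0 rmorph0.
rewrite ev_comp -[RHS]ev_id; congr (mmap _ _ P); apply: funext.
have c3 x : c ^+ 3 * (8 * x) = x by apply: mul_cube_half.
by apply: ord4; rewrite /= /L !(tnth_nth 0) /= ?evE /M !(tnth_nth 0) //= -/E -/K
  opprB [_ + (_ - _)]addrC subrK c3 addrK.
Qed.

Section BannaiIto.
Context (F : fieldType).
Hypothesis two_neq0 : 2 != 0 :> F.

Let X := bi_X F.
Let Y := bi_Y F.
Let Z := bi_Z F.
Let gens :=
  tnth [tuple X + Y + Z; bi_kappa X Y Z; bi_lambda X Y Z; bi_mu X Y Z].

Lemma bi_mmap_eq0 (P : {mpoly F[4]}) :
  mmap (in_alg (BannaiIto F)) gens P = 0 -> P = 0.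
Proof.
move=> P0.
pose c : {mpoly F[4]} := (2^-1)%:A.
have c2 : 2 * c = 1 by rewrite mulr_natl -scaler_nat scalerA divff // scale1r.
apply: quadratic_mmap_eq0 => //=; rewrite -/c.
set E := 'X_ _; set K := 'X_ _; set u := 'X_ _; set v := 'X_ _.
(* [p] and [q] are the elements to which [half_quadratic] applies with [w] equal to [v] and [u].
   Then [r] and [t] are solved from [p + q + r = E] and [2 * p * q - r + t = K]. *)
pose p := c ^+ 2 * (v + 2 * E + 1); pose q := c ^+ 2 * (u + 2 * E + 1).
pose r := E - p - q; pose t := K - 2 * p * q + r.
have := bi_mmap_specialize p q r t P0.
congr (mmap _ (tnth _) P = 0); apply/val_inj => /=; congr [:: _; _; _; _].
- by rewrite /r; ring.
- by rewrite /t; ring.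
- by rewrite (half_quadratic _ _ c2) -/q /t /r; ring.
- by rewrite (half_quadratic _ _ c2) -/p /t /r; ring.
Qed.

End BannaiIto.

(** * The image of the Casimir coset *)

Lemma rmorph_bi_comm (V W : nzRingType) (g : {rmorphism V -> W})
    (x y z v : V) :
  g (commutator (anticommutator x y - z) v) = 0 ->
  GRing.comm (anticommutator (g x) (g y) - g z) (g v).
Proof. by rewrite rmorph_commutator_bi => /subr0_eq. Qed.

Lemma rmorph_commutator_double (V W : nzRingType) (g : {rmorphism V -> W})
    (x y z : V) :
  g (commutator x y - 2 * z) = 0 -> commutator (g x) (g y) = 2 * g z.
Proof.
by rewrite rmorphB rmorph_commutator rmorphM rmorph_nat => /subr0_eq.
Qed.

Section Central.
Context (F : fieldType) (v : BannaiIto F).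

Let relation (r : free_alg F 3) : bi_relator r ->
  quot_proj (@bi_relator_proper F) r = 0 := @pres_relation _ _ _ _ r.

Lemma bi_kappa_comm : GRing.comm (bi_kappa (bi_X F) (bi_Y F) (bi_Z F)) v.
Proof.
elim/quot_algW: v => w.
exact (rmorph_bi_comm (relation (bi_rel_kappa w))).
Qed.

Lemma bi_lambda_comm : GRing.comm (bi_lambda (bi_X F) (bi_Y F) (bi_Z F)) v.
Proof.
elim/quot_algW: v => w.
exact (rmorph_bi_comm (relation (bi_rel_lambda w))).
Qed.

Lemma bi_mu_comm : GRing.comm (bi_mu (bi_X F) (bi_Y F) (bi_Z F)) v.
Proof.
elim/quot_algW: v => w.
exact (rmorph_bi_comm (relation (bi_rel_mu w))).
Qed.
End Central.

Lemma racah_commutatorAB (F : fieldType) :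
  commutator (racah_A F) (racah_B F) = 2 * racah_D F.
Proof.
exact (rmorph_commutator_double
  (pres_relation (@racah_relator_proper F) (racah_relAB F))).
Qed.

(** * Polynomial expressions in commuting elements *)

Lemma prodrM_comm (R : pzSemiRingType) (I : Type) (s : seq I) (f g : I -> R) :
  (forall i j, GRing.comm (f i) (g j)) ->
  \prod_(i <- s) (f i * g i) = (\prod_(i <- s) f i) * \prod_(i <- s) g i.
Proof.
move=> fg; elim: s => [|i s IHs]; rewrite ?big_nil ?mulr1 // !big_cons IHs.
rewrite -!mulrA; congr (_ * _); rewrite !mulrA; congr (_ * _).
by apply/esym/commr_sym/commr_prod => j _; apply/commr_sym/fg.
Qed.

Section MmapImage.
Context (F : fieldType) (V : algType F) (n : nat) (h : 'I_n -> V).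
Hypothesis h_comm : forall i j, GRing.comm (h i) (h j).

Definition mmap_image (v : V) : bool :=
  `[< exists P : {mpoly F[n]}, v = mmap (in_alg V) h P >].

Lemma mmap_image_gen i : h i \in mmap_image.
Proof. by apply/asboolP; exists 'X_i; rewrite mmapX mmap1U. Qed.

(** The target is not commutative, so multiplicativity of [mmap] has to be derived: it holds on
    monomials because the values of [h] commute, and extends by linearity. *)
Lemma mmap_image_subalg : GRing.subalg_closed mmap_image.
Proof.
have mmap1D m m' : mmap1 h (m + m')%MM = mmap1 h m * mmap1 h m'.
  rewrite /mmap1 -prodrM_comm => [|i j]; last first.
    exact/commrX/commr_sym/commrX.
  by apply: eq_bigr => i _; rewrite mnmDE exprD.
have mmap_mul P Q :
    mmap (in_alg V) h (P * Q) = mmap (in_alg V) h P * mmap (in_alg V) h Q.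
  rewrite [P in LHS]mpolyE [Q in LHS]mpolyE mulr_suml raddf_sum mulr_suml.
  apply: eq_bigr => m _; rewrite mulr_sumr raddf_sum mulr_sumr.
  apply: eq_bigr => m' _; rewrite -scalerAl -scalerAr -mpolyXD /= !mmapZ !mmapX.
  by rewrite mmap1D /= !mulr_algl -!scalerAl -!scalerAr.
split.
- by apply/asboolP; exists 1; rewrite -mpolyC1 mmapC /= scale1r.
- move=> a u v /asboolP[P ->] /asboolP[Q ->]; apply/asboolP.
  by exists (a *: P + Q); rewrite mmapD mmapZ /= mulr_algl.
- move=> u v /asboolP[P ->] /asboolP[Q ->]; apply/asboolP.
  by exists (P * Q); rewrite mmap_mul.
Qed.

End MmapImage.

(** * Clearing powers of 2 *)

Section Scaling.
Context (F : fieldType) (V : algType F).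
Hypothesis two_neq0 : 2 != 0 :> F.
Implicit Types (A B C D : V) (k m : F).

Lemma natr_scale n (v : V) : n%:R * v = (n%:R : F) *: v.
Proof. by rewrite mulr_natl scaler_nat. Qed.

Lemma commutatorZ k m (x y : V) :
  commutator (k *: x) (m *: y) = (k * m) *: commutator x y.
Proof.
by rewrite /commutator -!scalerAl -!scalerAr !scalerA [m * k]mulrC -scalerBr.
Qed.

Lemma anticommutatorZ k m (x y : V) :
  anticommutator (k *: x) (m *: y) = (k * m) *: anticommutator x y.
Proof.
by rewrite /anticommutator -!scalerAl -!scalerAr !scalerA [m * k]mulrC
  -scalerDr.
Qed.

Lemma mulrZZ k m (x y : V) : (k *: x) * (m *: y) = (k * m) *: (x * y).
Proof. by rewrite -scalerAl -scalerAr scalerA. Qed.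

Lemma racah_alphaZ A B C D :
  let a := 2 ^+ 4 *: A in let b := 2 ^+ 4 *: B in let c := 2 ^+ 4 *: C in
  let d := 2 ^+ 5 *: D in
  commutator a d + 2 * (a * c - b * a) = 2 ^+ 9 *: racah_alpha A B C D.
Proof.
rewrite /= commutatorZ !mulrZZ -scalerBr natr_scale scalerA.
have -> : 2 * (2 ^+ 4 * 2 ^+ 4) = 2 ^+ 4 * 2 ^+ 5 :> F by ring.
by rewrite -scalerDr addrA -exprD.
Qed.

(** The base point of the Casimir coset, with alpha, beta, delta as free arguments so that it can be
    rescaled and mapped term by term. *)
Definition casimir_base (A B D al be dl : V) : V :=
  D ^+ 2 + A ^+ 2 + B ^+ 2
  + 2^-1 *: ((dl + 2) * anticommutator A B
             - anticommutator (A ^+ 2) B - anticommutator A (B ^+ 2))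
  + A * (be - dl) - B * (dl + al).

Lemma casimir_baseZ A B D al be dl :
  let a := 2 ^+ 4 *: A in let b := 2 ^+ 4 *: B in let d := 2 ^+ 5 *: D in
  let al' := 2 ^+ 9 *: al in let be' := 2 ^+ 9 *: be in
  let dl' := 2 ^+ 4 *: dl in
  8 * d ^+ 2 + 32 * (a ^+ 2 + b ^+ 2) + (dl' + 32) * anticommutator a b
  - anticommutator (a ^+ 2) b - anticommutator a (b ^+ 2)
  + a * (be' - 32 * dl') - b * (32 * dl' + al')
  = 2 ^+ 13 *: casimir_base A B D al be dl.
Proof.
move=> a b d al' be' dl'; rewrite /casimir_base.
have n32 : 32 = 2 ^+ 5 :> F by ring.
(* Splits 32 so that [dl' + 32] becomes [2 ^+ 4 *: (dl + 2)]. *)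
have v32 : 32 = 2 ^+ 4 *: 2 :> V.
  by rewrite -[32]mulr1 natr_scale n32 exprSr -scalerA -natr_scale mulr1.
have -> : 8 * d ^+ 2 = 2 ^+ 13 *: D ^+ 2.
  by rewrite natr_scale /d exprZn scalerA; congr (_ *: _); ring.
have -> : 32 * (a ^+ 2 + b ^+ 2) = 2 ^+ 13 *: (A ^+ 2 + B ^+ 2).
  by rewrite natr_scale /a /b !exprZn -scalerDr scalerA; congr (_ *: _); ring.
have -> : (dl' + 32) * anticommutator a b
    = 2 ^+ 12 *: ((dl + 2) * anticommutator A B).
  rewrite v32 /dl' /a /b -scalerDr anticommutatorZ mulrZZ.
  by congr (_ *: _); ring.
have -> : anticommutator (a ^+ 2) b = 2 ^+ 12 *: anticommutator (A ^+ 2) B.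
  by rewrite /a /b exprZn anticommutatorZ; congr (_ *: _); ring.
have -> : anticommutator a (b ^+ 2) = 2 ^+ 12 *: anticommutator A (B ^+ 2).
  by rewrite /a /b exprZn anticommutatorZ; congr (_ *: _); ring.
have dl9 : 32 * dl' = 2 ^+ 9 *: dl.
  by rewrite natr_scale /dl' scalerA n32 -exprD.
have -> : a * (be' - 32 * dl') = 2 ^+ 13 *: (A * (be - dl)).
  by rewrite dl9 /a /b /al' /be' -scalerBr mulrZZ -exprD.
have -> : b * (32 * dl' + al') = 2 ^+ 13 *: (B * (dl + al)).
  by rewrite dl9 /a /b /al' /be' -scalerDr mulrZZ -exprD.
have half : 2 ^+ 13 * 2^-1 = 2 ^+ 12 :> F by rewrite exprSr mulfK.
by rewrite !(scalerDr, scalerN) !scalerA half !addrA.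
Qed.

End Scaling.

(** * Values in the Bannai-Ito algebra *)

Section CasimirImage.
Context (F : fieldType) (V : algType F) (X Y Z A B C D : V).
Hypothesis two_neq0 : 2 != 0 :> F.
Hypothesis central_kappa : forall v, GRing.comm (bi_kappa X Y Z) v.
Hypothesis central_lambda : forall v, GRing.comm (bi_lambda X Y Z) v.
Hypothesis central_mu : forall v, GRing.comm (bi_mu X Y Z) v.
Hypothesis AE : A = 16^-1 *: ((2 * X - 3) * (2 * X + 1)).
Hypothesis BE : B = 16^-1 *: ((2 * Y - 3) * (2 * Y + 1)).
Hypothesis CE : C = 16^-1 *: ((2 * Z - 3) * (2 * Z + 1)).
Hypothesis DE : commutator A B = 2 * D.

Let i := X + Y + Z.
Let k := bi_kappa X Y Z.
Let l := bi_lambda X Y Z.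
Let m := bi_mu X Y Z.

Let n16 : 16 = 2 ^+ 4 :> F. Proof. by ring. Qed.

Let two_powK n (u v : V) : 2 ^+ n *: u = v -> u = (2 ^+ n)^-1 *: v.
Proof. by move=> <-; rewrite scalerA mulVf ?scale1r ?expf_neq0. Qed.

Let AE' : (2 * X - 3) * (2 * X + 1) = 2 ^+ 4 *: A.
Proof. by rewrite AE n16 scalerA divff ?scale1r ?expf_neq0. Qed.
Let BE' : (2 * Y - 3) * (2 * Y + 1) = 2 ^+ 4 *: B.
Proof. by rewrite BE n16 scalerA divff ?scale1r ?expf_neq0. Qed.
Let CE' : (2 * Z - 3) * (2 * Z + 1) = 2 ^+ 4 *: C.
Proof. by rewrite CE n16 scalerA divff ?scale1r ?expf_neq0. Qed.

(** The commutator of the rescaled A and B is 2^8 (2 D), and also 16 times the left side. *)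
Let DE' : commutator (X * X - X) (Y * Y - Y) = 2 ^+ 5 *: D.
Proof.
have := bi_commutator_AB central_kappa central_lambda central_mu.
rewrite AE' BE' commutatorZ DE !natr_scale scalerA n16 => /esym/two_powK ->.
by rewrite scalerA -mulrA mulKf ?expf_neq0 // -exprSr.
Qed.

Lemma racah_alpha_bi :
  racah_alpha A B C D = (2 ^+ 9)^-1 *: (8 * ((m - k) * (m + k + 3 - 2 * i))).
Proof.
apply: two_powK; rewrite -racah_alphaZ -AE' -BE' -CE' -DE'.
exact: bi_alphaE.
Qed.

Lemma racah_beta_bi :
  racah_beta A B C D = (2 ^+ 9)^-1 *: (8 * ((k - l) * (k + l + 3 - 2 * i))).
Proof.
(* Beta is alpha after the cyclic shift of A, B, C with D fixed; gamma below is the next shift. *)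
apply: two_powK; rewrite -[racah_beta A B C D]/(racah_alpha B C A D).
rewrite -racah_alphaZ -AE' -BE' -CE' -DE'.
exact: bi_betaE.
Qed.

Lemma racah_gamma_bi :
  racah_gamma A B C D = (2 ^+ 9)^-1 *: (8 * ((l - m) * (l + m + 3 - 2 * i))).
Proof.
apply: two_powK; rewrite -[racah_gamma A B C D]/(racah_alpha C A B D).
rewrite -racah_alphaZ -AE' -BE' -CE' -DE'.
exact: bi_gammaE.
Qed.

Lemma racah_delta_bi :
  A + B + C = (2 ^+ 4)^-1 *: (4 * i ^+ 2 - 8 * i - 4 * (k + l + m) - 9).
Proof.
by apply: two_powK; rewrite !scalerDr -AE' -BE' -CE'; apply: bi_deltaE.
Qed.

Lemma casimir_base_bi :
  casimir_base A B D (racah_alpha A B C D) (racah_beta A B C D) (A + B + C)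
  = (2 ^+ 13)^-1 *: bi_casimir_poly i k l m.
Proof.
apply: two_powK; rewrite -casimir_baseZ // -AE' -BE' -DE'.
rewrite racah_alpha_bi racah_beta_bi racah_delta_bi.
rewrite !scalerA !divff ?scale1r ?expf_neq0 //.
exact: bi_casimirE.
Qed.

Variable S : {pred V}.
Hypothesis S_subalg : GRing.subalg_closed S.
Hypothesis Si : i \in S.
Hypothesis Sk : k \in S.
Hypothesis Sl : l \in S.
Hypothesis Sm : m \in S.

Let S1 : 1 \in S. Proof. by case: S_subalg. Qed.
Let SM x y : x \in S -> y \in S -> x * y \in S.
Proof. by case: S_subalg => _ _; apply. Qed.
Let S0 : 0 \in S.
Proof.
by case: S_subalg => _ + _ => /(_ (-1) 1 1 S1 S1); rewrite scaleN1r addNr.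
Qed.
Let SZ a x : x \in S -> a *: x \in S.
Proof. by case: S_subalg => _ + _ Sx => /(_ a x 0 Sx S0); rewrite addr0. Qed.
Let SD x y : x \in S -> y \in S -> x + y \in S.
Proof.
by case: S_subalg => _ + _ Sx Sy => /(_ 1 x y Sx Sy); rewrite scale1r.
Qed.
Let SN x : x \in S -> - x \in S.
Proof. by rewrite -scaleN1r; apply: SZ. Qed.
Let Sn n : n%:R \in S.
Proof. by rewrite -[n%:R]mulr1 natr_scale; apply: SZ. Qed.

(** Higher powers in [bi_casimir_poly] are built from squares, so the rule for [^+ 2] suffices, here
    and in [reify]. *)
Ltac in_subalg :=
  lazymatch goal with
  | |- is_true (_ *: _ \in _) => apply: SZ; in_subalg
  | |- is_true (_ + _ \in _) => apply: SD; in_subalg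
  | |- is_true (- _ \in _) => apply: SN; in_subalg
  | |- is_true (_%:R \in _) => exact: Sn
  | |- is_true (_ * _ \in _) => apply: SM; in_subalg
  | |- is_true (_ ^+ 2 \in _) => apply: SM; in_subalg
  | |- _ => assumption
  end.

Lemma casimir_base_image :
  casimir_base A B D (racah_alpha A B C D) (racah_beta A B C D) (A + B + C)
    \in S.
Proof. by rewrite casimir_base_bi /bi_casimir_poly; in_subalg. Qed.

Lemma racah_center_image :
  {subset [:: racah_alpha A B C D; racah_beta A B C D; racah_gamma A B C D;
              A + B + C] <= S}.
Proof.
apply/allP; rewrite /= andbT.
by apply/and4P; split;
  rewrite ?(racah_alpha_bi, racah_beta_bi, racah_gamma_bi, racah_delta_bi);
  in_subalg.
Qed.

End CasimirImage.

Lemma rmorph_racah_alpha (V W : nzRingType) (g : {rmorphism V -> W})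
    (A B C D : V) :
  g (racah_alpha A B C D) = racah_alpha (g A) (g B) (g C) (g D).
Proof. by rewrite /racah_alpha rmorphB rmorphD rmorph_commutator !rmorphM. Qed.

Lemma lrmorph_casimir_base (F : fieldType) (V W : algType F)
    (g : {lrmorphism V -> W}) (A B D al be dl : V) :
  g (casimir_base A B D al be dl)
  = casimir_base (g A) (g B) (g D) (g al) (g be) (g dl).
Proof.
rewrite /casimir_base /anticommutator !(rmorphB, rmorphD) /= linearZ /=.
by rewrite !(rmorphB, rmorphD, rmorphM) rmorph1 -!expr2.
Qed.

Lemma subalg_closed_preimage (F : fieldType) (V W : algType F)
    (g : {lrmorphism V -> W}) (S : {pred W}) :
  GRing.subalg_closed S -> GRing.subalg_closed [pred v | g v \in S].
Proof.
case=> S1 SZD SM; split=> [|a x y|x y]; rewrite !inE.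
- by rewrite rmorph1.
- by rewrite linearP; apply: SZD.
- by rewrite rmorphM; apply: SM.
Qed.

Section CasimirHomomorphism.
Context (F : fieldType) (R V : algType F) (zeta : {lrmorphism R -> V}).
Context (A B C D : R) (X Y Z : V).
Hypothesis two_neq0 : 2 != 0 :> F.
Hypothesis central_kappa : forall v, GRing.comm (bi_kappa X Y Z) v.
Hypothesis central_lambda : forall v, GRing.comm (bi_lambda X Y Z) v.
Hypothesis central_mu : forall v, GRing.comm (bi_mu X Y Z) v.
Hypothesis zeta_A : zeta A = 16^-1 *: ((2 * X - 3) * (2 * X + 1)).
Hypothesis zeta_B : zeta B = 16^-1 *: ((2 * Y - 3) * (2 * Y + 1)).
Hypothesis zeta_C : zeta C = 16^-1 *: ((2 * Z - 3) * (2 * Z + 1)).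
Hypothesis commutatorAB : commutator A B = 2 * D.

Let alpha := racah_alpha A B C D.
Let beta := racah_beta A B C D.
Let gamma := racah_gamma A B C D.
Let delta := A + B + C.

Lemma casimir_image (S : {pred V}) (c : R) :
  GRing.subalg_closed S ->
  X + Y + Z \in S -> bi_kappa X Y Z \in S ->
  bi_lambda X Y Z \in S -> bi_mu X Y Z \in S ->
  generated_subalg [:: alpha; beta; gamma; delta] c ->
  zeta (casimir_base A B D alpha beta delta + c) \in S.
Proof.
move=> S_subalg Si Sk Sl Sm c_gen; have [_ SZD _] := S_subalg.
have zeta_D : commutator (zeta A) (zeta B) = 2 * zeta D.
  by rewrite -rmorph_commutator commutatorAB rmorphM rmorph_nat.
have alphaE := rmorph_racah_alpha zeta A B C D.
have betaE : zeta beta = racah_beta _ _ _ _ := rmorph_racah_alpha zeta B C A D.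
have gammaE : zeta gamma = racah_gamma _ _ _ _ :=
  rmorph_racah_alpha zeta C A B D.
have deltaE : zeta delta = zeta A + zeta B + zeta C by rewrite !rmorphD.
set base := casimir_base _ _ _ _ _ _.
have -> : zeta (base + c) = 1 *: zeta base + zeta c by rewrite scale1r rmorphD.
apply: SZD.
  rewrite /base lrmorph_casimir_base alphaE betaE deltaE.
  exact: (casimir_base_image two_neq0 central_kappa central_lambda central_mu
    zeta_A zeta_B zeta_C zeta_D).
(* Membership in the generated subalgebra is tested on the preimage of [S] under [zeta]. *)
apply: (c_gen _ (subalg_closed_preimage zeta S_subalg)); apply/allP.
have /allP := racah_center_image two_neq0 central_kappa central_lambda
  central_mu zeta_A zeta_B zeta_C zeta_D S_subalg Si Sk Sl Sm.
by rewrite /= !inE alphaE betaE gammaE deltaE.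
Qed.

End CasimirHomomorphism.

Theorem theorem6p8 (F : fieldType) (char_neq2 : 2%N \notin [pchar F])
    (zeta : {lrmorphism Racah F -> BannaiIto F})
    (zeta_A : zeta (racah_A F)
              = 16^-1 *: ((2 * bi_X F - 3) * (2 * bi_X F + 1)))
    (zeta_B : zeta (racah_B F)
              = 16^-1 *: ((2 * bi_Y F - 3) * (2 * bi_Y F + 1)))
    (zeta_C : zeta (racah_C F)
              = 16^-1 *: ((2 * bi_Z F - 3) * (2 * bi_Z F + 1)))
    (Omega : Racah F) (Omega_casimir : is_casimir Omega) :
  let X := bi_X F in
  let Y := bi_Y F in
  let Z := bi_Z F in
  let iota := X + Y + Z in
  let kappa := bi_kappa X Y Z in
  let lambda := bi_lambda X Y Z in
  let mu := bi_mu X Y Z in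
  exists! P : {mpoly F[4]},
    zeta Omega
    = mmap (in_alg (BannaiIto F)) (tnth [tuple iota; kappa; lambda; mu]) P.
Proof.
move=> X Y Z i k l m.
have two_neq0 : 2 != 0 :> F by move: char_neq2; rewrite inE.
set h := tnth _.
have h_comm u v : GRing.comm (h u) (h v).
  (* Index 0 is iota and the others are central, so the one remaining pair is iota with itself. *)
  have central w j : GRing.comm (h (lift ord0 w)) j.
    case: w => -[|[|[|//]]] lt_w; rewrite /h (tnth_nth 0) /=.
    - exact: bi_kappa_comm.
    - exact: bi_lambda_comm.
    - exact: bi_mu_comm.
  case: (unliftP ord0 u) => [u' ->|->]; first exact: central.
  by case: (unliftP ord0 v) => [v' ->|->] //; apply/commr_sym/central.
(* The subalgebra [S] of [casimir_image] is taken to be the set of polynomial values at [h]. *)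
have image_subalg := mmap_image_subalg h_comm.
have h0 : i \in mmap_image h := mmap_image_gen h (@Ordinal 4 0 isT).
have h1 : k \in mmap_image h := mmap_image_gen h (@Ordinal 4 1 isT).
have h2 : l \in mmap_image h := mmap_image_gen h (@Ordinal 4 2 isT).
have h3 : m \in mmap_image h := mmap_image_gen h (@Ordinal 4 3 isT).
have [P zetaE] : exists P, zeta Omega = mmap (in_alg (BannaiIto F)) h P.
  apply/asboolP; case: Omega_casimir => c c_center ->.
  exact: (casimir_image two_neq0 (@bi_kappa_comm F) (@bi_lambda_comm F)
    (@bi_mu_comm F) zeta_A zeta_B zeta_C (racah_commutatorAB F)
    image_subalg h0 h1 h2 h3 c_center).
(* Two solutions differ by a polynomial that vanishes at [h], which algebraic independence forces to
   be 0. *)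
exists P; split=> // Q zetaE'; apply/eqP; rewrite -subr_eq0; apply/eqP.
by apply: (bi_mmap_eq0 two_neq0); rewrite mmapB -zetaE -zetaE' subrr.
Qed.
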